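(* Let $f,g:[a,b]\to\mathbb{R}$ be such that $f$ is of bounded variation on $[a,b]$ and $g$ is of $p$-$H$-Hölder type on $[a,b]$, where $p\in(0,1]$ and $H>0$ are given. Then $$\left|\mathcal{T}_a^v(f,g)-\mathcal{T}_u^b(f,g)\right|\le H\,\frac{(v-a)^p+(b-u)^p}{2^{p+1}(p+1)}\bigvee_a^b(f)$$ and $$\left|\mathcal{T}_a^v(f,g)-\mathcal{T}_u^b(f,g)\right|\le \frac{H}{2^p(p+1)}\left[\frac{(v-a)+(b-u)}{2}+\left|\frac{v-a}{2}-\frac{b-u}{2}\right|\right]^p\cdot\bigvee_a^b(f)$$ for all $a\le u<v\le b$.
   Context: For real numbers $\alpha<\beta$ and functions $f,g$ on $[\alpha,\beta]$ (with the integrals existing), the Čebyšev functional is $$\mathcal{T}_\alpha^\beta(f,g)=\frac{1}{\beta-\alpha}\int_\alpha^\beta f(t)g(t)\,dt-\frac{1}{\beta-\alpha}\int_\alpha^\beta f(t)\,dt\cdot\frac{1}{\beta-\alpha}\int_\alpha^\beta g(t)\,dt.$$ $\bigvee_a^b(f)$ denotes the total variation of $f$ on $[a,b]$. A function $g$ is of $p$-$H$-Hölder type on $[a,b]$ if $|g(x)-g(y)|\le H|x-y|^p$ for all $x,y\in[a,b]$. *)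

(* Defs.v *)
From HB Require Import structures.
From mathcomp Require Import all_boot all_order all_algebra.
From mathcomp Require Import all_classical all_reals all_analysis.
Import Order.TTheory GRing.Theory Num.Theory.
Import numFieldNormedType.Exports.
Set Implicit Arguments.
Unset Strict Implicit.
Unset Printing Implicit Defensive.
Local Open Scope classical_set_scope.
Local Open Scope ring_scope.

(* Functions on [a, b] are represented by total functions R -> R of which only
   the values on [a, b] are ever used.  Integrals are Lebesgue integrals; for
   the functions of interest (bounded variation times continuous) they exist
   and agree with the Riemann integrals. *)

Definition cebysev (R : realType) (alpha beta : R) (f g : R -> R) : R :=
  (beta - alpha)^-1 * (\int[lebesgue_measure]_(t in `[alpha, beta]) (f t * g t))
  - ((beta - alpha)^-1 * (\int[lebesgue_measure]_(t in `[alpha, beta]) f t))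
    * ((beta - alpha)^-1 * (\int[lebesgue_measure]_(t in `[alpha, beta]) g t)).

(* For p > 0, the case x = y is harmless since 0 `^ p = 0. *)
Definition holder_type (R : realType) (a b p H : R) (g : R -> R) : Prop :=
  forall x y : R, x \in `[a, b] -> y \in `[a, b] ->
    `|g x - g y| <= H * `|x - y| `^ p.

(* Main.v *)
Require Import Defs.
From HB Require Import structures.
From mathcomp Require Import all_boot all_order all_algebra.
From mathcomp Require Import all_classical all_reals all_analysis.
From mathcomp Require Import measurable_realfun.
From mathcomp Require Import ring lra.
Import Order.TTheory GRing.Theory Num.Theory.
Import numFieldNormedType.Exports.
Set Implicit Arguments.
Unset Strict Implicit.
Unset Printing Implicit Defensive.
Local Open Scope classical_set_scope.
Local Open Scope ring_scope.

(** Write L = be - al for the length of an interval [al, be], M for the mean of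
    g on it, h = g - M, and G for the primitive of h vanishing at al.  Both
    inequalities follow, by the triangle inequality, from a bound on a single
    functional,
      |T_al^be(f, g)| <= H L^p / (4 (p + 1)) * V_a^b(f),
    since 2^(p+1) <= 4 when p <= 1, and since v - a and b - u are both at most
    their maximum, which is the bracket of the second inequality.

    That bound has two sources.

    - Bounded variation of f.  One has L T(f, g) = int f h, and G vanishes at
      both ends, so a Stieltjes integration by parts would give
      L T(f, g) = - int G df, whence |L T(f, g)| <= sup |G| * V(f).  No
      Stieltjes integral is constructed: the increments of
      S(t) = int_al^t f h - f(t) G(t) are compared with those of a
      nondecreasing F dominating the increments of f (the running total
      variation), up to an error of second order that a fine subdivision
      removes (dominated_increments_Rintegral_le, increment_bound_refine).

    - Hoelder continuity of g.  For x in [al, be], L G(x) is the difference of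
      (be - x) int_al^x g and (x - al) int_x^be g.  Both integrals are rescaled
      to [0, 1] by maps reflecting the two sides of x onto each other,
      s |-> x - (x - al) s and s |-> x + (be - x) s; these two points are at
      distance L s, so
      |L G(x)| <= (x - al) (be - x) H L^p int_0^1 s^p ds
      and (x - al) (be - x) <= L^2 / 4 (reflected_increment_le,
      holder_centered_primitive_le). *)

(** * Removing a second-order error by subdivision *)

(** The extra term K (y - x) is multiplied by an increment of F, so over n equal
    steps these terms add up to K (F be - F al) times the mesh, which tends to
    0. *)
Lemma increment_bound_refine (R : realType) (al be K C : R) (S F : R -> R) :
  al <= be ->
  (forall x y, al <= x -> x <= y -> y <= be ->
    `|S y - S x| <= (F y - F x) * (K * (y - x) + C)) ->
  `|S be - S al| <= (F be - F al) * C.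
Proof.
move=> ab hS.
suff hn (n : nat) : `|S be - S al| <=
    (F be - F al) * (K * ((be - al) / n.+1%:R) + C).
  apply/ler_addgt0Pr => e e0.
  pose D := (F be - F al) * K * (be - al).
  have [n Dn] : exists n : nat, D / e < n.+1%:R.
    by exists (Num.truncn (D / e)); exact: truncnS_gt.
  apply: (le_trans (hn n)).
  have -> : (F be - F al) * (K * ((be - al) / n.+1%:R) + C) =
      (F be - F al) * C + D / n.+1%:R by rewrite /D; ring.
  rewrite lerD2l ler_pdivrMr ?ltr0n// mulrC -ler_pdivrMr//.
  exact: ltW.
(* Telescope along the n + 1 steps of length d. *)
pose d := (be - al) / n.+1%:R.
have d0 : 0 <= d by rewrite /d divr_ge0// subr_ge0.
have nd : n.+1%:R * d = be - al by rewrite /d mulrC divfK// pnatr_eq0.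
have hk (k : nat) : (k <= n.+1)%N ->
    `|S (al + k%:R * d) - S al| <= (F (al + k%:R * d) - F al) * (K * d + C).
  elim: k => [_|k IH kn]; first by rewrite mul0r addr0 !subrr normr0 mul0r.
  have kd0 : 0 <= k%:R * d by rewrite mulr_ge0.
  have kd : k.+1%:R * d <= be - al by rewrite -nd ler_wpM2r// ler_nat.
  have kS : k.+1%:R * d = k%:R * d + d by rewrite -natr1 mulrDl mul1r.
  have := hS (al + k%:R * d) (al + k.+1%:R * d).
  have -> : al + k.+1%:R * d - (al + k%:R * d) = d by rewrite kS; ring.
  move=> h1; have {}h1 := h1 ltac:(lra) ltac:(lra) ltac:(lra).
  rewrite -(subrKA (S (al + k%:R * d)) (S (al + k.+1%:R * d))).
  rewrite -(subrKA (F (al + k%:R * d)) (F (al + k.+1%:R * d))) mulrDl.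
  exact: le_trans (ler_normD _ _) (lerD h1 (IH (ltnW kn))).
have := hk n.+1 (leqnn _).
by rewrite nd addrCA subrr addr0.
Qed.

(** * Hoelder functions on a segment *)

(** Precomposition with the retraction of the line onto [al, be] turns
    regularity on the segment into regularity on the whole line. *)
Definition clamp (R : realType) (al be x : R) : R := Num.max al (Num.min x be).

Lemma clamp_itv (R : realType) (al be x : R) :
  al <= be -> clamp al be x \in `[al, be].
Proof.
move=> ab; rewrite in_itv/= /clamp le_max lexx/= ge_max ab/= ge_min lexx orbT.
by [].
Qed.

Lemma clamp_id (R : realType) (al be x : R) :
  x \in `[al, be] -> clamp al be x = x.
Proof.
by rewrite in_itv/= => /andP[ax xb]; rewrite /clamp min_l// max_r.
Qed.

Lemma clamp_nondecreasing (R : realType) (al be : R) :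
  nondecreasing_fun (clamp al be).
Proof. by move=> x y xy; rewrite /clamp le_max2// le_min2. Qed.

Lemma clamp_contraction (R : realType) (al be x y : R) :
  al <= be -> `|clamp al be x - clamp al be y| <= `|x - y|.
Proof.
move=> ab; wlog xy : x y / x <= y.
  move=> hw; have [/hw//|/ltW/hw] := leP x y.
  by rewrite distrC (distrC x).
rewrite distrC (distrC x) !ger0_norm ?subr_ge0//; last exact: clamp_nondecreasing.
rewrite /clamp; have [yb|yb] := leP y be.
  have xb : x <= be by exact: le_trans yb.
  rewrite (min_l xb).
  by have [ay|ay] := leP al y; have [ax|ax] := leP al x; lra.
have [xb|xb] := leP x be; last by rewrite subrr subr_ge0.
by rewrite (max_r ab); have [ax|ax] := leP al x; lra.
Qed.

Lemma bounded_integrable_itv (R : realType) (al be M : R) (f : R -> R) :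
  measurable_fun `[al, be] f -> (forall x, x \in `[al, be] -> `|f x| <= M) ->
  lebesgue_measure.-integrable `[al, be] (EFin \o f).
Proof.
move=> mf fM; apply: measurable_bounded_integrable => //.
  by rewrite /= lebesgue_measure_itv/=; case: ifPn => _; rewrite ?ltry// -EFinD ltry.
exists M; split; first exact: num_real.
by move=> N MN x /fM; move/le_trans; apply; exact: ltW.
Qed.

Lemma holder_clamp_continuous (R : realType) (al be p H : R) (g : R -> R) :
  al <= be -> 0 < p -> 0 < H -> holder_type al be p H g ->
  continuous (g \o clamp al be).
Proof.
move=> ab p0 H0 hg x; apply/cvgrPdist_le => /= e e0.
have d0 : 0 < (e / H) `^ p^-1 by rewrite powR_gt0// divr_gt0.
near=> y.
apply: (le_trans (hg _ _ (clamp_itv _ ab) (clamp_itv _ ab))).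
rewrite -ler_pdivlMl// mulrC.
(* The modulus of continuity is inverted: d = (e / H)^(1/p) solves H d^p = e. *)
rewrite (_ : e / H = ((e / H) `^ p^-1) `^ p); last first.
  by rewrite -powRrM mulVf ?gt_eqF// powRr1// divr_ge0// ltW.
rewrite ge0_ler_powR ?nnegrE// ?(ltW p0)// ?(ltW d0)//.
apply: le_trans (clamp_contraction _ _ ab) _.
by near: y; apply: cvgr_dist_le.
Unshelve. all: by end_near. Qed.

Lemma holder_measurable (R : realType) (al be p H : R) (g : R -> R) :
  al <= be -> 0 < p -> 0 < H -> holder_type al be p H g ->
  measurable_fun `[al, be] g.
Proof.
move=> ab p0 H0 hg.
apply: (eq_measurable_fun (g \o clamp al be)).
  by move=> x; rewrite inE/= => xab; rewrite clamp_id.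
apply: measurable_funTS; apply: continuous_measurable_fun.
exact: holder_clamp_continuous hg.
Qed.

Lemma holder_bounded (R : realType) (al be p H : R) (g : R -> R) :
  al <= be -> 0 < p -> 0 < H -> holder_type al be p H g ->
  forall x, x \in `[al, be] -> `|g x| <= `|g al| + H * (be - al) `^ p.
Proof.
move=> ab p0 H0 hg x xab; have := xab; rewrite in_itv/= => /andP[ax xb].
rewrite -[X in `|X| <= _](subrKC (g al)).
apply: le_trans (ler_normD _ _) _; rewrite lerD2l.
have aab : al \in `[al, be] by rewrite in_itv/= lexx.
apply: (le_trans (hg _ _ xab aab)).
rewrite ler_pM2l// ge0_ler_powR ?nnegrE ?(ltW p0)// ?subr_ge0//.
by rewrite ger0_norm ?subr_ge0// lerD2r.
Qed.

Lemma Rintegral_chasles (R : realType) (al be x y : R) (f : R -> R) :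
  lebesgue_measure.-integrable `[al, be] (EFin \o f) ->
  al <= x -> x <= y -> y <= be ->
  \int[lebesgue_measure]_(t in `[al, y]) f t =
  \int[lebesgue_measure]_(t in `[al, x]) f t +
  \int[lebesgue_measure]_(t in `[x, y]) f t.
Proof.
move=> intf ax xy yb.
have inty : lebesgue_measure.-integrable `[al, y] (EFin \o f).
  by apply: integrableS intf => //; apply: subset_itvl; rewrite bnd_simp.
rewrite -(@Rintegral_itv_obnd_cbnd _ x); last first.
  apply: integrableS inty => //; apply: subset_itv => //=.
by rewrite -(@Rintegral_itvB _ _ (BLeft al) (BRight y) x)// addrC subrK.
Qed.

(** Integrating the clamped function from al - 1 makes the primitive two-sidedly
    differentiable at the end points al and be as well, so that no one-sided
    derivative is ever needed. *)
Lemma holder_primitive (R : realType) (al be p H : R) (g : R -> R) :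
  al <= be -> 0 < p -> 0 < H -> holder_type al be p H g ->
  exists2 A : R -> R, forall x, x \in `[al, be] -> is_derive x 1 A (g x) &
    forall x y, al <= x -> x <= y -> y <= be ->
      \int[lebesgue_measure]_(t in `[x, y]) g t = A y - A x.
Proof.
move=> ab p0 H0 hg.
have cg := holder_clamp_continuous ab p0 H0 hg.
have intg : lebesgue_measure.-integrable `[al - 1, be + 1]
    (EFin \o (g \o clamp al be)).
  apply: bounded_integrable_itv.
    by apply: measurable_funTS; exact: continuous_measurable_fun.
  by move=> x _; apply: holder_bounded hg _ (clamp_itv _ _).
exists (fun x => \int[lebesgue_measure]_(t in `[al - 1, x]) (g \o clamp al be) t).
  move=> x xab; have := xab; rewrite in_itv/= => /andP[ax xb].
  have [] := @continuous_FTC1_closed _ (g \o clamp al be) (al - 1) x (be + 1)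
    _ intg _ (cg x).
  - lra.
  - lra.
  - move=> dA; rewrite derive1E /= clamp_id// => <-.
move=> x y ax xy yb.
rewrite (@Rintegral_chasles _ (al - 1) (be + 1) x y)//; [|lra|lra].
rewrite addrC addKr; apply: eq_Rintegral => t; rewrite inE/= in_itv/= => /andP[xt ty].
by rewrite clamp_id// in_itv/= (le_trans ax)// (le_trans ty).
Qed.

(** * The primitive of a centered Hoelder function *)

(** Continuity is only claimed on the nonnegative side: [s `^ q] is 1 for
    s < 0, so it jumps at 0. *)
Lemma powR_within_continuous (R : realType) (q : R) : 0 < q ->
  {within `[0 : R, 1], continuous (fun s : R => s `^ q)}.
Proof.
move=> q0; have cpos (s : R) : 0 < s -> {for s, continuous (fun s : R => s `^ q)}.
  move=> s0; apply: differentiable_continuous; apply/derivable1_diffP.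
  by apply: derivable_powR; rewrite in_itv/= s0.
apply/continuous_within_itvP => //; split.
- by move=> s; rewrite in_itv/= => /andP[s0 _]; exact: cpos.
- by rewrite powR0 ?gt_eqF//; exact: powR_cvg0.
- by apply: cvg_at_left_filter; exact: cpos.
Qed.

(** The left-hand side is (x - al) int_x^be g - (be - x) int_al^x g.  It is the
    increment over [0, 1] of D, whose derivative at s compares the values of g
    at two points on either side of x, at distance (be - al) s of each other.
    The mean value theorem applied to E - D, with E a multiple of s^(p+1), then
    stands for the integration of s^p over [0, 1]. *)
Lemma reflected_increment_le (R : realType) (al be x p H : R) (g A : R -> R) :
  al <= x -> x <= be -> 0 < p -> 0 < H -> holder_type al be p H g ->
  (forall t, t \in `[al, be] -> is_derive t 1 A (g t)) ->
  (x - al) * (A be - A x) - (be - x) * (A x - A al) <=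
  H / (p + 1) * ((x - al) * (be - x) * (be - al) `^ p).
Proof.
move=> ax xb p0 H0 hg dA.
have rpos (s : R) : 0 <= s -> s <= 1 -> x + (be - x) * s \in `[al, be].
  by move=> s0 s1; rewrite in_itv/=; apply/andP; split; nra.
have lpos (s : R) : 0 <= s -> s <= 1 -> x - (x - al) * s \in `[al, be].
  by move=> s0 s1; rewrite in_itv/=; apply/andP; split; nra.
pose D (s : R) := (x - al) * A (x + (be - x) * s) + (be - x) * A (x - (x - al) * s).
pose dD (s : R) := (x - al) * (g (x + (be - x) * s) * (be - x)) +
  (be - x) * (g (x - (x - al) * s) * - (x - al)).
have isD (s : R) : 0 <= s -> s <= 1 -> is_derive s 1 D (dD s).
  move=> s0 s1; apply: is_deriveD.
    apply: is_deriveZ.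
    apply: (@is_derive1_comp _ A (fun s : R => x + (be - x) * s)).
      exact/dA/rpos.
    by apply: is_derive_eq; rewrite /GRing.scale/=; ring.
  apply: is_deriveZ.
  apply: (@is_derive1_comp _ A (fun s : R => x - (x - al) * s)).
    exact/dA/lpos.
  by apply: is_derive_eq; rewrite /GRing.scale/=; ring.
pose cc := (x - al) * (be - x) * (H * (be - al) `^ p).
pose E (s : R) := cc / (p + 1) * s `^ (p + 1).
pose Phi (s : R) := E s - D s.
have isE (s : R) : 0 < s -> is_derive s 1 E (cc * s `^ p).
  move=> s0.
  have -> : cc * s `^ p = (cc / (p + 1)) *: ((p + 1) * s `^ (p + 1 - 1)).
    by rewrite addrK /GRing.scale/= mulrA divfK// gt_eqF//; lra.
  apply: (is_deriveZ (f := fun s : R => s `^ (p + 1))).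
  exact: is_derive1_powR.
have dPhi (s : R) : s \in `]0, 1[ ->
    is_derive s 1 Phi (cc * s `^ p - dD s).
  rewrite in_itv/= => /andP[s0 s1].
  by apply: is_deriveB; [exact: isE|apply: isD; exact: ltW].
have cPhi : {within `[0, 1], continuous Phi}.
  move=> z; apply: continuousB.
    apply: continuousM; first exact: cvg_cst.
    by apply: powR_within_continuous; lra.
  move: z; apply: continuous_in_subspaceT => s; rewrite inE/= in_itv/= => /andP[s0 s1].
  apply: differentiable_continuous; apply/derivable1_diffP.
  by have [] := isD s s0 s1.
have [c] := @MVT R Phi (fun s => cc * s `^ p - dD s) 0 1 ltr01 dPhi cPhi.
rewrite in_itv/= => /andP[c0 c1]; rewrite subr0 mulr1 => PhiE.
have : 0 <= cc * c `^ p - dD c.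
  have -> : dD c = (x - al) * (be - x) *
      (g (x + (be - x) * c) - g (x - (x - al) * c)) by rewrite /dD; ring.
  rewrite subr_ge0 /cc -!mulrA !ler_wpM2l ?subr_ge0//.
  apply: le_trans (ler_norm _) _.
  apply: (le_trans (hg _ _ (rpos _ (ltW c0) (ltW c1)) (lpos _ (ltW c0) (ltW c1)))).
  rewrite ler_pM2l// (_ : _ - _ = (be - al) * c); last by ring.
  have ba0 : 0 <= be - al by rewrite subr_ge0 (le_trans ax).
  by rewrite ger0_norm ?powRM ?mulr_ge0 ?(ltW c0).
rewrite -PhiE /Phi /E /D powR1 powR0; last by rewrite gt_eqF//; lra.
rewrite !mulr0 !mulr1 !addr0 !subr0 (subrKC x) subKr.
have -> : cc / (p + 1) = H / (p + 1) * ((x - al) * (be - x) * (be - al) `^ p).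
  by rewrite /cc; ring.
by move=> h; lra.
Qed.

Lemma holder_typeN (R : realType) (al be p H : R) (g : R -> R) :
  holder_type al be p H g -> holder_type al be p H (\- g).
Proof. by move=> hg x y xab yab; rewrite /= -opprD normrN; exact: hg. Qed.

Lemma holder_typeW (R : realType) (a b al be p H : R) (g : R -> R) :
  a <= al -> be <= b -> holder_type a b p H g -> holder_type al be p H g.
Proof.
move=> aal beb hg x y; rewrite !in_itv/= => /andP[ax xb] /andP[ay yb].
by apply: hg; rewrite in_itv/= ?(le_trans aal)// (le_trans _ beb).
Qed.

Lemma holder_integrable (R : realType) (al be p H : R) (g : R -> R) :
  al <= be -> 0 < p -> 0 < H -> holder_type al be p H g ->
  lebesgue_measure.-integrable `[al, be] (EFin \o g).
Proof.
move=> ab p0 H0 hg; apply: bounded_integrable_itv.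
  exact: holder_measurable hg.
exact: holder_bounded hg.
Qed.

Lemma Rintegral_itv_cst (R : realType) (al be k : R) : al <= be ->
  \int[lebesgue_measure]_(_ in `[al, be]) k = k * (be - al).
Proof.
move=> ab; rewrite Rintegral_cst//= lebesgue_measure_itv/= lte_fin.
case: ltP => [//|ba].
by rewrite (_ : be - al = 0)//; lra.
Qed.

Definition mean (R : realType) (al be : R) (g : R -> R) : R :=
  (be - al)^-1 * \int[lebesgue_measure]_(t in `[al, be]) g t.

(** The bound of [reflected_increment_le] is used for g and for - g, and
    (x - al) (be - x) is largest at the midpoint. *)
Lemma holder_centered_primitive_le (R : realType) (al be p H x : R)
    (g : R -> R) :
  al < be -> 0 < p -> 0 < H -> holder_type al be p H g -> x \in `[al, be] ->
  `|\int[lebesgue_measure]_(t in `[al, x]) (g t - mean al be g)| <=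
  H / (4 * (p + 1)) * (be - al) `^ p * (be - al).
Proof.
move=> ab p0 H0 hg; rewrite in_itv/= => /andP[ax xb].
have L0 : 0 < be - al by rewrite subr_gt0.
have [A dA intA] := holder_primitive (ltW ab) p0 H0 hg.
have hgx := holder_typeW (lexx al) xb hg.
rewrite RintegralB//; last 2 first.
- exact: holder_integrable hgx.
- by apply: (@bounded_integrable_itv _ _ _ `|mean al be g|).
rewrite Rintegral_itv_cst// intA// /mean intA ?(ltW ab)//.
have hp := reflected_increment_le ax xb p0 H0 hg dA.
have dAN t : t \in `[al, be] -> is_derive t 1 (\- A) ((\- g) t).
  by move=> tab; apply: is_deriveN; exact: dA.
have hn := reflected_increment_le ax xb p0 H0 (holder_typeN hg) dAN.
have q4 : (x - al) * (be - x) * 4 <= (be - al) * (be - al).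
  by have := sqr_ge0 ((x - al) - (be - x)); rewrite expr2; nra.
(* Z is -(be - al) times the integral to be bounded. *)
set Z := (x - al) * (A be - A x) - (be - x) * (A x - A al) in hp.
have ZH : `|Z| <= H / (p + 1) * ((x - al) * (be - x) * (be - al) `^ p).
  rewrite ler_norml hp andbT lerNl; apply: le_trans hn.
  by rewrite le_eqVlt; apply/orP; left; apply/eqP; rewrite /Z /=; ring.
have -> : A x - A al - (be - al)^-1 * (A be - A al) * (x - al) =
    - Z / (be - al).
  by rewrite /Z; field; rewrite gt_eqF.
rewrite normrM normrN normfV (gtr0_norm L0) ler_pdivrMr//.
apply: (le_trans ZH).
have -> : H / (4 * (p + 1)) * (be - al) `^ p * (be - al) * (be - al) =
  H / (p + 1) * ((be - al) * (be - al) / 4 * (be - al) `^ p).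
  by field; rewrite gt_eqF//; lra.
have p1 : 0 <= p + 1 by lra.
rewrite ler_wpM2l ?divr_ge0 ?(ltW H0)// ler_wpM2r ?powR_ge0//.
by rewrite ler_pdivlMr.
Qed.

(** * Integration by parts against dominated increments *)

Lemma normr_Rintegral_itv_le (R : realType) (x y M : R) (f : R -> R) :
  x <= y -> lebesgue_measure.-integrable `[x, y] (EFin \o f) ->
  (forall t, t \in `[x, y] -> `|f t| <= M) ->
  `|\int[lebesgue_measure]_(t in `[x, y]) f t| <= M * (y - x).
Proof.
move=> xy intf fM; apply: le_trans (le_normr_Rintegral _ _) _ => //.
rewrite -Rintegral_itv_cst//; apply: le_Rintegral => //.
- exact: integrable_norm.
- by apply: (@bounded_integrable_itv _ _ _ `|M|).
Qed.

(** With G the primitive of h from al and S(y) = int_al^y f h - f(y) G(y), the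
    increment of S over [x, y] is
    int_x^y (f - f(y)) h - (f(y) - f(x)) G(x),
    which is at most (F(y) - F(x)) (K (y - x) + C).  As G(be) = 0, the total
    increment of S is int_al^be f h. *)
Lemma dominated_increments_Rintegral_le (R : realType) (al be K C : R)
    (f F h : R -> R) :
  al <= be ->
  (forall x y, al <= x -> x <= y -> y <= be -> `|f y - f x| <= F y - F x) ->
  (forall t, t \in `[al, be] -> `|h t| <= K) ->
  lebesgue_measure.-integrable `[al, be] (EFin \o h) ->
  lebesgue_measure.-integrable `[al, be] (EFin \o (f \* h)) ->
  (forall x, x \in `[al, be] ->
    `|\int[lebesgue_measure]_(t in `[al, x]) h t| <= C) ->
  \int[lebesgue_measure]_(t in `[al, be]) h t = 0 ->
  `|\int[lebesgue_measure]_(t in `[al, be]) (f t * h t)| <= (F be - F al) * C.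
Proof.
move=> ab fF hK inth intfh hC h0.
pose G y := \int[lebesgue_measure]_(t in `[al, y]) h t.
pose S y := \int[lebesgue_measure]_(t in `[al, y]) (f t * h t) - f y * G y.
have <- : S be - S al = \int[lebesgue_measure]_(t in `[al, be]) (f t * h t).
  by rewrite /S /G h0 set_itv1 !Rintegral_set1 !mulr0 !subr0.
apply: (increment_bound_refine (K := K)) => // x y ax xy yb.
have sub : `[x, y] `<=` `[al, be] by apply: subset_itv; rewrite bnd_simp.
have inthx : lebesgue_measure.-integrable `[x, y] (EFin \o h).
  exact: integrableS inth.
have intfhx : lebesgue_measure.-integrable `[x, y] (EFin \o (f \* h)).
  exact: integrableS intfh.
have intyh : lebesgue_measure.-integrable `[x, y] (EFin \o (fun t => f y * h t)).
  by apply: eq_integrable (integrableZl _ (f y) inthx).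
have -> : S y - S x =
    \int[lebesgue_measure]_(t in `[x, y]) (f t * h t - f y * h t) -
    (f y - f x) * G x.
  rewrite RintegralB// RintegralZl// /S /G.
  rewrite (Rintegral_chasles intfh ax xy yb) (Rintegral_chasles inth ax xy yb).
  by ring.
have Fxy : 0 <= F y - F x by apply: le_trans (fF _ _ ax xy yb).
apply: le_trans (ler_normB _ _) _; rewrite mulrDr lerD//.
- rewrite mulrA; apply: normr_Rintegral_itv_le => //.
    by apply: eq_integrable (integrableB _ intfhx intyh).
  move=> t; rewrite in_itv/= => /andP[xt ty].
  rewrite -mulrBl normrM ler_pM// ?hK//.
    rewrite distrC (le_trans (fF _ _ _ ty yb)) ?(le_trans ax)//.
    rewrite lerD2l lerN2 -subr_ge0.
    exact: le_trans (fF _ _ ax xt (le_trans ty yb)).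
  by rewrite in_itv/= (le_trans ax)// (le_trans ty).
- rewrite normrM ler_pM// ?fF// hC// in_itv/= ax; exact: le_trans yb.
Qed.

(** F + f and F are both nondecreasing, and f is their difference. *)
Lemma dominated_increments_measurable (R : realType) (al be : R)
    (f F : R -> R) : al <= be ->
  (forall x y, al <= x -> x <= y -> y <= be -> `|f y - f x| <= F y - F x) ->
  measurable_fun `[al, be] f.
Proof.
move=> ab fF.
have fFc x y : x <= y -> `|f (clamp al be y) - f (clamp al be x)| <=
    F (clamp al be y) - F (clamp al be x).
  move=> xy; have /andP[ax _] := clamp_itv x ab.
  have /andP[_ yb] := clamp_itv y ab.
  by apply: fF => //; exact: clamp_nondecreasing.
apply: (eq_measurable_fun (((F \+ f) \o clamp al be) \- (F \o clamp al be))).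
  by move=> x; rewrite inE/= => xab; rewrite clamp_id// addrC addKr.
apply: measurable_funB; apply: nondecreasing_measurable => // x y xy /=.
- by have := fFc _ _ xy; rewrite ler_norml => /andP[]; lra.
- by have := le_trans (normr_ge0 _) (fFc _ _ xy); lra.
Qed.

(** * Bounds on a single functional *)

(** Subtracting its mean from g does not change the functional, and makes the
    primitive of g vanish at both ends of the interval. *)
Lemma cebysev_le (R : realType) (al be p H : R) (f F g : R -> R) :
  al < be -> 0 < p -> 0 < H -> holder_type al be p H g ->
  (forall x y, al <= x -> x <= y -> y <= be -> `|f y - f x| <= F y - F x) ->
  `|cebysev al be f g| <=
    H / (4 * (p + 1)) * (be - al) `^ p * (F be - F al).
Proof.
move=> ab p0 H0 hg fF; have leab := ltW ab.
have L0 : 0 < be - al by rewrite subr_gt0.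
have mf := dominated_increments_measurable leab fF.
have mg := holder_measurable leab p0 H0 hg.
have bf t : t \in `[al, be] -> `|f t| <= `|f al| + (F be - F al).
  rewrite in_itv/= => /andP[at_ tb].
  rewrite -[X in `|X| <= _](subrKC (f al)).
  apply: le_trans (ler_normD _ _) _; rewrite lerD2l.
  apply: (le_trans (fF _ _ (lexx _) at_ tb)); rewrite lerD2r -subr_ge0.
  exact: le_trans (fF _ _ at_ tb (lexx _)).
have bg := holder_bounded leab p0 H0 hg.
set Bf := `|f al| + _ in bf; set Bg := `|g al| + _ in bg.
set M := mean al be g.
have intf := bounded_integrable_itv mf bf.
have intg := bounded_integrable_itv mg bg.
have intM : lebesgue_measure.-integrable `[al, be] (EFin \o cst M).
  by apply: (@bounded_integrable_itv _ _ _ `|M|).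
have intfg : lebesgue_measure.-integrable `[al, be] (EFin \o (f \* g)).
  apply: (@bounded_integrable_itv _ _ _ (Bf * Bg)).
    exact: measurable_funM.
  by move=> t tab; rewrite normrM ler_pM// ?bf ?bg.
have intfM : lebesgue_measure.-integrable `[al, be] (EFin \o (fun t => f t * M)).
  by apply: eq_integrable (integrableZr _ M intf).
have inth : lebesgue_measure.-integrable `[al, be] (EFin \o (fun t => g t - M)).
  by apply: eq_integrable (integrableB _ intg intM).
have intfh : lebesgue_measure.-integrable `[al, be]
    (EFin \o (f \* (fun t => g t - M))).
  rewrite (_ : _ \o _ = EFin \o (fun t => f t * g t - f t * M)).
    by apply: eq_integrable (integrableB _ intfg intfM).
  by apply/funext => t /=; rewrite mulrBr.
have -> : cebysev al be f g = (be - al)^-1 *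
    \int[lebesgue_measure]_(t in `[al, be]) (f t * (g t - M)).
  under eq_Rintegral do rewrite mulrBr.
  rewrite RintegralB// RintegralZr// /cebysev -/(mean al be g) -/M.
  by ring.
rewrite normrM gtr0_norm ?invr_gt0// ler_pdivrMl//.
have := @dominated_increments_Rintegral_le _ al be (Bg + `|M|)
  (H / (4 * (p + 1)) * (be - al) `^ p * (be - al)) f F (fun t => g t - M) leab fF.
move=> /(_ _ inth intfh).
rewrite (_ : (be - al) * _ =
  (F be - F al) * (H / (4 * (p + 1)) * (be - al) `^ p * (be - al))); last by ring.
apply.
- by move=> t tab; apply: le_trans (ler_normB _ _) _; rewrite lerD2r bg.
- by move=> x xab; exact: holder_centered_primitive_le.
- rewrite RintegralB// Rintegral_itv_cst// /M /mean mulrAC mulVf ?gt_eqF//.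
  by rewrite mul1r subrr.
Qed.

(** The running total variation is the dominating function to which the
    preceding estimates are applied. *)
Lemma total_variation_dominates (R : realType) (a b : R) (f : R -> R) :
  bounded_variation a b f -> forall x y, a <= x -> x <= y -> y <= b ->
  `|f y - f x| <= fine (total_variation a y f) - fine (total_variation a x f).
Proof.
move=> bvf x y ax xy yb.
have bvy : bounded_variation a y f.
  by apply: bounded_variationl bvf => //; exact: le_trans xy.
have fx : total_variation a x f \is a fin_num.
  by apply/bounded_variationP => //; exact: bounded_variationl bvy.
have fxy : total_variation x y f \is a fin_num.
  by apply/bounded_variationP => //; exact: bounded_variationr bvy.
rewrite (total_variationD f ax xy) fineD// [leRHS]addrC addKr.
by rewrite -lee_fin fineK// total_variation_ge.
Qed.

(** The constant 4 comes from the midpoint in (x - al) (be - x) <= L^2 / 4; it is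
    only weakened to 2^(p+1), which is where p <= 1 is used. *)
Lemma cebysev_total_variation_le (R : realType) (a b al be p H : R)
    (f g : R -> R) :
  a <= al -> al < be -> be <= b -> 0 < p -> p <= 1 -> 0 < H ->
  bounded_variation a b f -> holder_type a b p H g ->
  `|cebysev al be f g| <= H / (2 `^ (p + 1) * (p + 1)) * (be - al) `^ p *
    fine (total_variation a b f).
Proof.
move=> aal ab beb p0 p1 H0 bvf hg.
have fF := total_variation_dominates bvf.
apply: le_trans (@cebysev_le _ al be p H f _ g ab p0 H0
  (holder_typeW aal beb hg) (fun x y ax xy yb =>
   fF x y (le_trans aal ax) xy (le_trans yb beb))) _.
have Fbe := le_trans (normr_ge0 _) (fF _ _ (le_trans aal (ltW ab)) beb (lexx b)).
have Fal : 0 <= fine (total_variation a al f).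
  by rewrite fine_ge0// total_variation_ge0.
have Fab := le_trans (normr_ge0 _) (fF _ _ aal (ltW ab) beb).
have c4 : 2 `^ (p + 1) <= 4 :> R.
  have -> : 4 = 2 `^ 2 :> R by rewrite powR_mulrn// -natrX.
  by rewrite ler_powR//; lra.
have p10 : 0 < p + 1 by lra.
rewrite ler_pM//; last lra.
  by rewrite mulr_ge0 ?powR_ge0// divr_ge0// ?(ltW H0)// mulr_ge0// ltW.
rewrite ler_wpM2r ?powR_ge0// ler_wpM2l ?(ltW H0)// lef_pV2 ?posrE; last 2 first.
- by rewrite mulr_gt0.
- by rewrite mulr_gt0// powR_gt0.
by rewrite ler_pM2r.
Qed.

Theorem theorem5 (R : realType) (a b : R) (hab : a < b) (p H : R)
  (hp0 : 0 < p) (hp1 : p <= 1) (hH : 0 < H) (f g : R -> R)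
  (hf : bounded_variation a b f) (hg : holder_type a b p H g) :
  forall u v : R, a <= u -> u < v -> v <= b ->
    `|cebysev a v f g - cebysev u b f g| <=
      H * (((v - a) `^ p + (b - u) `^ p) / (2 `^ (p + 1) * (p + 1)))
        * fine (total_variation a b f)
    /\
    `|cebysev a v f g - cebysev u b f g| <=
      H / (2 `^ p * (p + 1))
        * (((v - a) + (b - u)) / 2 + `|(v - a) / 2 - (b - u) / 2|) `^ p
        * fine (total_variation a b f).
Proof.
move=> u v au uv vb.
have h1 := cebysev_total_variation_le (lexx a) (le_lt_trans au uv) vb
  hp0 hp1 hH hf hg.
have h2 := cebysev_total_variation_le au (lt_le_trans uv vb) (lexx b)
  hp0 hp1 hH hf hg.
set V := fine _ in h1 h2 *.
have V0 : 0 <= V by rewrite fine_ge0// total_variation_ge0// ltW.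
have first : `|cebysev a v f g - cebysev u b f g| <=
    H * (((v - a) `^ p + (b - u) `^ p) / (2 `^ (p + 1) * (p + 1))) * V.
  apply: le_trans (ler_normB _ _) _; apply: le_trans (lerD h1 h2) _.
  by rewrite le_eqVlt; apply/orP; left; apply/eqP; ring.
split=> //; apply: (le_trans first); rewrite ler_wpM2r//.
(* m is the larger of v - a and b - u. *)
set m := _ + `|_|.
have [vm um] : v - a <= m /\ b - u <= m.
  have := ler_norm ((v - a) / 2 - (b - u) / 2).
  have := ler_norm (- ((v - a) / 2 - (b - u) / 2)).
  by rewrite normrN /m; split; lra.
have va0 : 0 <= v - a by lra.
have bu0 : 0 <= b - u by lra.
have vmp : (v - a) `^ p <= m `^ p.
  by rewrite ge0_ler_powR ?nnegrE ?(ltW hp0)//; lra.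
have ump : (b - u) `^ p <= m `^ p.
  by rewrite ge0_ler_powR ?nnegrE ?(ltW hp0)//; lra.
have P0 : 0 < 2 `^ p :> R by rewrite powR_gt0.
have -> : 2 `^ (p + 1) = 2 `^ p * 2 :> R.
  by rewrite powRD ?powRr1// pnatr_eq0 implybT.
have -> : H / (2 `^ p * (p + 1)) * m `^ p =
    H * ((m `^ p + m `^ p) / (2 `^ p * 2 * (p + 1))).
  by field; rewrite !gt_eqF//; lra.
rewrite ler_wpM2l ?(ltW hH)// ler_wpM2r ?lerD//.
by rewrite invr_ge0 !mulr_ge0// ltW//; lra.
Qed.
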